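(* Let $\mathbb{K}$ be a field and $R=\mathbb{K}[x_1,\dots,x_n]$. Let $I\subset R$ be a squarefree monomial ideal and let $I=\bigcap_{i=1}^r\mathfrak{p}_i$ be a minimal prime decomposition of $I$. If $I$ is ass-decomposable, then $\mathrm{reg}(R/I)\leq r-1$.
   Context: $R$ has the standard grading. For a finitely generated graded $R$-module $M\ne 0$, $\mathrm{reg}(M)=\sup\{j-i : \mathrm{Tor}_i^R(M,\mathbb{K})_j\neq0\}$ is the Castelnuovo-Mumford regularity; for a nonzero ideal $I$, $\mathrm{reg}(R/I)=\mathrm{reg}(I)-1$. A minimal prime decomposition of a squarefree monomial ideal is an irredundant intersection of (pairwise incomparable) prime ideals, so $r$ is the number of minimal primes of $I$. For an ideal $I\subseteq R$, $\mathrm{ass}(I)$ is the set of associated primes of $R/I$. Recursively, a (proper) monomial ideal $I\subset R$ is called ass-decomposable if either it is a primary ideal, or else there exist a variable $x_i\notin\sqrt{I}$ and a positive integer $k$ such that (i) $\mathrm{ass}(I+(x_i^k))=\{\mathfrak{p}\in\mathrm{ass}(I) : x_i\in\mathfrak{p}\}$, and (ii) both $I+(x_i^k)$ and $I:x_i^k$ are ass-decomposable. *)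

(* Defs.v *)
From HB Require Import structures.
From mathcomp Require Import all_boot all_order all_algebra.
From mathcomp Require Export mpoly.

Set Implicit Arguments.
Unset Strict Implicit.
Unset Printing Implicit Defensive.

Import Order.TTheory GRing.Theory Num.Theory.
Local Open Scope ring_scope.

Section Ideals.

Variables (K : fieldType) (n : nat).
Local Notation R := {mpoly K[n]}.

(* Ideals are subsets of R, taken up to extensional equality [same_set]:
   membership in an arbitrary ideal need not be decidable, so these are Prop
   predicates rather than MathComp's boolean ideals. *)
Definition subset_of := R -> Prop.
Implicit Types (A B I J p : subset_of).

Definition sub_set A B := forall f, A f -> B f.
Definition same_set A B := forall f, A f <-> B f.

Definition is_ideal I :=
  [/\ I 0, forall f g, I f -> I g -> I (f + g)
    & forall f g, I g -> I (f * g)].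

Definition proper_ideal I := is_ideal I /\ ~ I 1.

Definition generated A : subset_of :=
  fun f => forall J, is_ideal J -> sub_set A J -> J f.

Definition monomials (S : 'X_{1..n} -> Prop) : subset_of :=
  fun f => exists2 m, S m & f = 'X_[m].

Definition monomial_ideal I :=
  exists S, same_set I (generated (monomials S)).

Definition squarefree_mnm (m : 'X_{1..n}) := forall i, (m i <= 1)%N.

Definition squarefree_monomial_ideal I :=
  exists2 S, (forall m, S m -> squarefree_mnm m)
           & same_set I (generated (monomials S)).

Definition is_prime p :=
  proper_ideal p /\ forall f g, p (f * g) -> p f \/ p g.

Definition radical I : subset_of := fun f => exists e : nat, I (f ^+ e).

Definition is_primary I :=
  proper_ideal I /\ forall f g, I (f * g) -> I f \/ radical I g.

Definition add_elt I (g : R) : subset_of :=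
  fun f => exists a b, I a /\ f = a + b * g.

Definition colon I (g : R) : subset_of := fun f => I (f * g).

(* p is the annihilator of the class of g in R/I. *)
Definition ass I p := is_prime p /\ exists g, same_set p (colon I g).

Inductive ass_decomposable I : Prop :=
| ass_decomposable_primary of
    monomial_ideal I & proper_ideal I & is_primary I
| ass_decomposable_split (i : 'I_n) (k : nat) of
    monomial_ideal I & proper_ideal I
  & ~ radical I 'X_i & (0 < k)%N
  & (forall p, ass (add_elt I ('X_i ^+ k)) p <-> ass I p /\ p 'X_i)
  & ass_decomposable (add_elt I ('X_i ^+ k))
  & ass_decomposable (colon I ('X_i ^+ k)).

Definition minimal_prime_decomposition (r : nat) I (p : 'I_r -> subset_of) :=
  [/\ forall i, is_prime (p i),
      forall f, I f <-> forall i, p i f,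
      forall i, ~ same_set I (fun f => forall j, j != i -> p j f)
    & forall i j, i != j -> ~ sub_set (p i) (p j)].

End Ideals.

Section Regularity.

Variables (K : fieldType) (n : nat).
Local Notation R := {mpoly K[n]}.

Definition zhomog (d : int) (f : R) : Prop :=
  match d with
  | Posz e => f \is e.-homog
  | Negz _ => f = 0
  end.

(* Graded resolutions
     ... -> F_2 -> F_1 -> F_0 -> R/I -> 0
   of R/I by free modules F_i = (+)_a R(- shift i a) of finite rank.  Elements
   of F_i are row vectors, on which [diff i : F_(i+1) -> F_i] acts on the
   right; [aug] lists representatives in R of the images in R/I of the basis
   of F_0.  All maps have degree 0. *)
Record graded_free_resolution (I : subset_of K n) := GradedFreeResolution {
  rank : nat -> nat;
  shift : forall i, 'I_(rank i) -> int;
  diff : forall i, 'M[R]_(rank i.+1, rank i);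
  aug : 'cV[R]_(rank 0%N);
  aug_homog : forall a, zhomog (shift a) (aug a 0);
  diff_homog : forall i a b, zhomog (shift a - shift b) (diff i a b);
  aug_surj : forall f, exists v : 'rV[R]_(rank 0%N), I (f - (v *m aug) 0 0);
  aug_exact : forall v : 'rV[R]_(rank 0%N),
    I ((v *m aug) 0 0) <-> exists w, v = w *m diff 0%N;
  diff_exact : forall i (v : 'rV[R]_(rank i.+1)),
    v *m diff i = 0 <-> exists w, v = w *m diff i.+1
}.

Section Tensor.

Variables (I : subset_of K n) (F : graded_free_resolution I).

(* F_i (x)_R K is K^(rank i), with the a-th basis vector in degree shift a;
   since K = R/(x_1, ..., x_n), the differentials become the matrices of
   constant coefficients. *)
Definition diffK i : 'M[K]_(rank F i.+1, rank F i) :=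
  map_mx (fun f : R => f@_0%MM) (diff F i).

Definition in_degree i (j : int) (v : 'rV[K]_(rank F i)) :=
  forall a, v 0 a != 0 -> shift a = j.

Definition is_cycle i : 'rV[K]_(rank F i) -> Prop :=
  match i with
  | 0%N => fun _ => True
  | i'.+1 => fun v => v *m diffK i' = 0
  end.

Definition is_boundary i (v : 'rV[K]_(rank F i)) :=
  exists w, v = w *m diffK i.

Definition homology_nonzero (i : nat) (j : int) :=
  exists v, [/\ @in_degree i j v, is_cycle v & ~ is_boundary v].

End Tensor.

(* Tor_i^R(R/I, K)_j <> 0.  Tor does not depend on the chosen resolution. *)
Definition Tor_nonzero (I : subset_of K n) (i : nat) (j : int) :=
  exists F : graded_free_resolution I, homology_nonzero F i j.

(* d = reg(R/I), as a least upper bound in the integers; in particular the set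
   of all j - i is nonempty and bounded above. *)
Definition is_reg (I : subset_of K n) (d : int) :=
  (forall i j, Tor_nonzero I i j -> j - i%:Z <= d) /\
  (forall e, (forall i j, Tor_nonzero I i j -> j - i%:Z <= e) -> d <= e).

End Regularity.

(* Main.v *)
Require Import Defs.
From mathcomp Require Import all_boot all_order all_algebra.
From mathcomp Require Import ring zify.
From Stdlib Require Import ClassicalEpsilon.

(** The bound holds for every proper intersection I of r primes generated by
    variables, because such an I can be cut down one variable at a time.  Write
    P_A for the prime generated by the variables in A, and let I be the
    intersection of P_A over the A in a list s of length r >= 1.  If some x lies
    in one A of s but not in another, consider the exact sequence

      0 -> R/(I : x)(-1) -> R/I -> R/(I + (x)) -> 0.

    The colon ideal I : x is the intersection of the P_A with x not in A, of
    which there is at least one and fewer than r.  The ideal I + (x) is the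
    intersection of the r primes P_(A + x), because monomial ideals form a
    distributive lattice.  By induction R/(I : x)(-1) has regularity at most (r - 2) + 1, and
    R/(I + (x)) at most r - 1, hence so has R/I.  If no such x exists, then all
    the A coincide, and R/P_A has regularity 0 by the Koszul resolution.

    Working with all lists of sets, repetitions and inclusions allowed, is what
    makes the induction close: I + (x) need not be irredundant.

    An upper bound on the regularity is handled as the existence of one graded
    free resolution whose generators in step i have degree at most i + d
    ([regularity_le]).  Such resolutions are glued by the horseshoe lemma
    ([regularity_le_horseshoe]); the Koszul resolution is built by mapping cones
    of multiplication by a variable ([regularity_le_cone]).  The comparison
    theorem transfers the bound to the homology computed from any other
    resolution: a chain endomorphism that factors through the bounded resolution
    is homotopic to the identity, and on a homology class of too large a degree
    it vanishes ([homology_shifts]).  Finally Tor_0 is nonzero in degree 0, so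
    the set of all j - i is nonempty and has a least upper bound
    ([is_reg_exists]).

    The given primes are replaced by the primes generated by the variables that
    they contain: a monomial lies in a prime ideal if and only if one of its
    variables does, so the intersection is still I
    ([monomial_ideal_prime_cap]). *)

Set Implicit Arguments.
Unset Strict Implicit.
Unset Printing Implicit Defensive.

Import Order.TTheory GRing.Theory Num.Theory.
Local Open Scope ring_scope.

(** * Dependent choice *)

(** Chain maps and homotopies are built degree by degree: P is the condition on
    the map in degree i that allows the next one to be found, Q the equation
    that ties them together. *)
Lemma dependent_choice_nat (X : nat -> Type) (P : forall i, X i -> Prop)
    (Q : forall i, X i -> X i.+1 -> Prop) (x0 : X 0%N) :
  P 0%N x0 -> (forall i x, P i x -> exists2 y, P i.+1 y & Q i x y) ->
  exists s : forall i, X i,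
    [/\ s 0%N = x0, forall i, P i (s i) & forall i, Q i (s i) (s i.+1)].
Proof.
move=> Px0 step.
have next i (x : {x | P i x}) : {y : {y | P i.+1 y} | Q i (sval x) (sval y)}.
  apply: constructive_indefinite_description.
  by have [y Py Qxy] := step i _ (svalP x); exists (exist _ y Py).
pose s := nat_rect (fun i => {x | P i x}) (exist _ x0 Px0)
  (fun i x => sval (next i x)).
exists (fun i => sval (s i)); split=> // i; first exact: (svalP (s i)).
exact: (svalP (next i (s i))).
Qed.

(** * Homogeneous components of polynomials and matrices *)

Section Graded.

Variables (K : fieldType) (n : nat).
Local Notation R := {mpoly K[n]}.
Implicit Types (d e : int) (f g : R).

Definition zcomp d f : R :=
  if d is Posz e then pihomog mdeg e f else 0.

Lemma zhomog0 d : zhomog d (0 : R).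
Proof. by case: d => [e|e] //=; exact: rpred0. Qed.

Lemma zhomogD d f g : zhomog d f -> zhomog d g -> zhomog d (f + g).
Proof.
by case: d => [e|e] /=; [exact: rpredD | move=> -> ->; rewrite addr0].
Qed.

Lemma zhomogN d f : zhomog d f -> zhomog d (- f).
Proof. by case: d => [e|e] /=; [rewrite rpredN | move=> ->; rewrite oppr0]. Qed.

Lemma zhomog_sum d (T : finType) (F : T -> R) :
  (forall i, zhomog d (F i)) -> zhomog d (\sum_i F i).
Proof.
by move=> h; elim/big_ind: _ => *; [exact: zhomog0 | exact: zhomogD | exact: h].
Qed.

Lemma zhomogX i : zhomog 1 ('X_i : R).
Proof. by rewrite /= dhomogX /= mdeg1. Qed.

Lemma zhomogM d e f g : zhomog d f -> zhomog e g -> zhomog (d + e) (f * g).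
Proof.
case: d => [d|d] /=; last by move=> -> _; rewrite mul0r; exact: zhomog0.
case: e => [e|e] /=.
  exact: dhomogM.
by move=> _ ->; rewrite mulr0; exact: (@zhomog0 (_ + Negz e)).
Qed.

Lemma zhomog_mcoeff0 d f : zhomog d f -> f@_0%MM != 0 -> d = 0.
Proof.
case: d => [d|d] /=; last by move=> ->; rewrite mcoeff0 eqxx.
move=> /dhomogP hf; rewrite -mcoeff_msupp => /hf /=; rewrite mdeg0.
by move=> <-.
Qed.

Lemma zcomp_homog d f : zhomog d (zcomp d f).
Proof. by case: d => [d|d] //=; exact: pihomogP. Qed.

Lemma zcomp_id d f : zhomog d f -> zcomp d f = f.
Proof. by case: d => [d|d] /=; [exact: pihomog_dE | move->]. Qed.

Lemma zcompD d : {morph zcomp d : f g / f + g}.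
Proof. by case: d => [d|d] f g /=; [exact: raddfD | rewrite addr0]. Qed.

Lemma zcompN d : {morph zcomp d : f / - f}.
Proof. by case: d => [d|d] f /=; [exact: raddfN | rewrite oppr0]. Qed.

Lemma zcompZ d (c : K) f : zcomp d (c *: f) = c *: zcomp d f.
Proof. by case: d => [d|d] /=; [exact: linearZ | rewrite scaler0]. Qed.

Lemma zcomp0 d : zcomp d 0 = 0.
Proof. by apply: zcomp_id; exact: zhomog0. Qed.

Lemma zcomp_sum d (T : finType) (F : T -> R) :
  zcomp d (\sum_i F i) = \sum_i zcomp d (F i).
Proof. exact: (big_morph _ (zcompD d) (zcomp0 d)). Qed.

Lemma zcompX d (m : 'X_{1..n}) :
  zcomp d ('X_[m] : R) = if d == (mdeg m)%:Z then 'X_[m] else 0.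
Proof. by case: d => [d|d] //=; rewrite pihomogX /= eqz_nat eq_sym. Qed.

Lemma zcomp_neq d e f : d != e -> zhomog e f -> zcomp d f = 0.
Proof.
case: d e => [d|d] [e|e] //= de; last by move->; exact: (@zcomp0 (Posz d)).
by apply: pihomog_ne0; rewrite eq_sym.
Qed.

(** Taking components is linear over multiplication by a homogeneous g.  The
    degrees range over the integers, so this covers d < 0 <= d + e, where both
    sides vanish. *)
Lemma zcompM d e f g : zhomog e g -> zcomp (d + e) (f * g) = zcomp d f * g.
Proof.
move=> hg; elim/mpolyind: f => [|c m p _ _ IH].
  by rewrite mul0r !zcomp0 mul0r.
rewrite mulrDl !zcompD IH mulrDl; congr (_ + _).
rewrite -scalerAl !zcompZ -scalerAl; congr (_ *: _).
have hXg : zhomog ((mdeg m)%:Z + e) ('X_[m] * g).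
  by apply: zhomogM hg; rewrite /= dhomogX.
rewrite zcompX; case: eqP => [->|/eqP ne]; first exact: zcomp_id.
by rewrite mul0r; apply: zcomp_neq hXg; apply: contra ne => /eqP/addIr ->.
Qed.

(** The matrices of the degree 0 maps between the graded free modules with
    generators in degrees s a and t b. *)
Definition homog_mx m1 m2 (s : 'I_m1 -> int) (t : 'I_m2 -> int)
    (A : 'M[R]_(m1, m2)) : Prop := forall a b, zhomog (s a - t b) (A a b).

Definition zcomp_mx m1 m2 (s : 'I_m1 -> int) (t : 'I_m2 -> int)
    (A : 'M[R]_(m1, m2)) := \matrix_(a, b) zcomp (s a - t b) (A a b).

Section Matrices.

Variables (m1 m2 m3 : nat).
Variables (s : 'I_m1 -> int) (t : 'I_m2 -> int) (u : 'I_m3 -> int).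

Lemma homog_mx_zcomp (A : 'M[R]_(m1, m2)) : homog_mx s t (zcomp_mx s t A).
Proof. by move=> a b; rewrite mxE; exact: zcomp_homog. Qed.

Lemma zcomp_mx_id (A : 'M[R]_(m1, m2)) : homog_mx s t A -> zcomp_mx s t A = A.
Proof. by move=> hA; apply/matrixP=> a b; rewrite mxE zcomp_id. Qed.

Lemma zcomp_mxM (A : 'M[R]_(m1, m2)) (B : 'M[R]_(m2, m3)) :
  homog_mx t u B -> zcomp_mx s u (A *m B) = zcomp_mx s t A *m B.
Proof.
move=> hB; apply/matrixP=> a c; rewrite !mxE zcomp_sum; apply: eq_bigr => b _.
by rewrite mxE -(zcompM _ _ (hB b c)) addrA subrK.
Qed.

Lemma homog_mxM (A : 'M[R]_(m1, m2)) (B : 'M[R]_(m2, m3)) :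
  homog_mx s t A -> homog_mx t u B -> homog_mx s u (A *m B).
Proof.
move=> hA hB a c; rewrite mxE; apply: zhomog_sum => b.
by rewrite -[s a](subrK (t b)) -addrA; apply: zhomogM.
Qed.

Lemma homog_mxN (A : 'M[R]_(m1, m2)) : homog_mx s t A -> homog_mx s t (- A).
Proof. by move=> hA a b; rewrite mxE; apply: zhomogN. Qed.

End Matrices.

Lemma homog_mx_shift m1 m2 (s : 'I_m1 -> int) (t : 'I_m2 -> int) e
    (A : 'M[R]_(m1, m2)) :
  homog_mx s (fun b => t b + e) A <-> homog_mx (fun a => s a - e) t A.
Proof.
have E a b : s a - (t b + e) = s a - e - t b by ring.
by split=> hA a b; [rewrite -E | rewrite E].
Qed.

Definition sum_shift m1 m2 (s1 : 'I_m1 -> int) (s2 : 'I_m2 -> int)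
    (a : 'I_(m1 + m2)) : int :=
  match split a with inl b => s1 b | inr b => s2 b end.

Lemma homog_mx_col m1 m2 m (s1 : 'I_m1 -> int) (s2 : 'I_m2 -> int)
    (t : 'I_m -> int) (A : 'M[R]_(m1, m)) (B : 'M[R]_(m2, m)) :
  homog_mx s1 t A -> homog_mx s2 t B ->
  homog_mx (sum_shift s1 s2) t (col_mx A B).
Proof.
by move=> hA hB a b; rewrite /sum_shift mxE; case: (split a) => a'.
Qed.

Lemma homog_mx_row m1 m2 m (s1 : 'I_m1 -> int) (s2 : 'I_m2 -> int)
    (t : 'I_m -> int) (A : 'M[R]_(m, m1)) (B : 'M[R]_(m, m2)) :
  homog_mx t s1 A -> homog_mx t s2 B ->
  homog_mx t (sum_shift s1 s2) (row_mx A B).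
Proof.
by move=> hA hB a b; rewrite /sum_shift mxE; case: (split b) => b'.
Qed.

Lemma homog_mx0 m1 m2 (s : 'I_m1 -> int) (t : 'I_m2 -> int) :
  homog_mx s t (0 : 'M[R]_(m1, m2)).
Proof. by move=> a b; rewrite mxE; exact: zhomog0. Qed.

Lemma homog_mx_scalar m (s : 'I_m -> int) e (g : R) : zhomog e g ->
  homog_mx (fun a => s a + e) s (g%:M).
Proof.
move=> hg a b; rewrite mxE; case: eqP => [->|_]; last exact: zhomog0.
by rewrite mulr1n addrAC subrr add0r.
Qed.

End Graded.

(** * Homogeneous ideals *)

Section Ideals.

Variables (K : fieldType) (n : nat).
Local Notation R := {mpoly K[n]}.
Implicit Types (I J : subset_of K n) (f g : R).

Lemma idealN I f : is_ideal I -> I f -> I (- f).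
Proof. by move=> [_ _ IM] If; rewrite -mulN1r; exact: IM. Qed.

Lemma idealB I f g : is_ideal I -> I f -> I g -> I (f - g).
Proof. by move=> hI If Ig; have [_ ID _] := hI; apply: ID (idealN hI Ig). Qed.

Lemma ideal_sum I (T : Type) (r : seq T) (P : pred T) (F : T -> R) :
  is_ideal I -> (forall i, P i -> I (F i)) -> I (\sum_(i <- r | P i) F i).
Proof. by move=> [I0 ID _] h; elim/big_ind: _. Qed.

Lemma ideal_mulmx I m1 m2 (W : 'M[R]_(m1, m2)) (b : 'cV[R]_m2) : is_ideal I ->
  (forall a, I (b a 0)) -> forall c, I ((W *m b) c 0).
Proof.
move=> hI Ib c; rewrite mxE; apply: ideal_sum => // a _.
by have [_ _ IM] := hI; apply: IM.
Qed.

Definition homogeneous_ideal I :=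
  is_ideal I /\ forall d f, I f -> I (zcomp d f).

Lemma add_elt_ideal I g : is_ideal I -> is_ideal (add_elt I g).
Proof.
move=> [I0 ID IM]; split.
- by exists 0, 0; rewrite mul0r addr0.
- move=> _ _ [a [b [Ia ->]]] [a' [b' [Ia' ->]]]; exists (a + a'), (b + b').
  by split; [exact: ID | rewrite mulrDl addrACA].
- move=> f _ [a [b [Ia ->]]]; exists (f * a), (f * b).
  by split; [exact: IM | rewrite mulrDr mulrA].
Qed.

Lemma add_eltP I g f : is_ideal I -> add_elt I g f <-> exists b, I (f - b * g).
Proof.
move=> hI; split=> [[a [b [Ia ->]]]|[b Ib]]; first by exists b; rewrite addrK.
by exists (f - b * g), b; rewrite subrK.
Qed.

(** Both lifts across an augmentation below come from this: a lift that exists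
    can be replaced by its component of the right degree, because the ideal is
    homogeneous. *)
Lemma lift_homog_mod I m1 m2 (s : 'I_m1 -> int)
    (t : 'I_m2 -> int) (f : 'cV[R]_m1) (b : 'cV[R]_m2) :
  homogeneous_ideal I -> homog_mx s (fun=> 0) f -> homog_mx t (fun=> 0) b ->
  (forall a, exists w : 'rV[R]_m2, I (f a 0 - (w *m b) 0 0)) ->
  exists2 W, homog_mx s t W & forall a, I ((f - W *m b) a 0).
Proof.
move=> [_ homI] hf hb /fin_all_exists[w Iw].
pose W : 'M[R]_(m1, m2) := \matrix_a w a.
exists (zcomp_mx s t W); first exact: homog_mx_zcomp.
move=> a; rewrite -(zcomp_mxM _ _ hb) -{1}(zcomp_mx_id hf).
have -> : (zcomp_mx s (fun=> 0) f - zcomp_mx s (fun=> 0) (W *m b)) a 0 =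
    zcomp (s a - 0) (f a 0 - (w a *m b) 0 0).
  have -> : (w a *m b) 0 0 = (W *m b) a 0.
    by rewrite -[w a](rowK w) -row_mul mxE.
  by rewrite zcompD zcompN 4!mxE.
exact: homI.
Qed.

End Ideals.

(** * Cycles and lifting in a graded free resolution *)

Section Resolutions.

Variables (K : fieldType) (n : nat).
Local Notation R := {mpoly K[n]}.
Implicit Types (I J : subset_of K n).

(** The rows of M are cycles of F in step i; in step 0 this is meant in the
    resolution augmented by R/I, so that exactness of F reads the same way in
    every step ([cyclesP]). *)
Definition cycles I (F : graded_free_resolution I) i m :
    'M[R]_(m, rank F i) -> Prop :=
  match i with
  | 0%N => fun M => forall a, I ((M *m aug F) a 0)
  | i'.+1 => fun M => M *m diff F i' = 0
  end.

Section Cycles.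
Variables (I : subset_of K n) (F : graded_free_resolution I).

Lemma cycles_row i m (M : 'M[R]_(m, rank F i)) :
  cycles M <-> forall a, cycles (row a M).
Proof.
case: i M => [|i] M /=.
  split=> [h a c|h a]; first by rewrite -row_mul mxE.
  by have := h a 0; rewrite -row_mul mxE.
split=> [h a|h]; first by rewrite -row_mul h row0.
by apply/row_matrixP=> a; rewrite row_mul h row0.
Qed.

Lemma cyclesP i m (M : 'M[R]_(m, rank F i)) :
  cycles M <-> exists W, M = W *m diff F i.
Proof.
have rowP (v : 'rV[R]_(rank F i)) :
    cycles v <-> exists w, v = w *m diff F i.
  case: i {M} v => [|i] v; last exact: diff_exact.
  by rewrite -aug_exact /=; split=> [|h a] //; rewrite ord1.
rewrite cycles_row; split=> [h|[W ->] a].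
  have [w hw] := fin_all_exists (fun a => (rowP _).1 (h a)).
  exists (\matrix_a w a); apply/row_matrixP=> a.
  by rewrite hw row_mul rowK.
by apply/rowP; exists (row a W); rewrite row_mul.
Qed.

Lemma cycles_diff i : cycles (diff F i).
Proof. by apply/cyclesP; exists 1%:M; rewrite mul1mx. Qed.

Lemma diff_diff i : diff F i.+1 *m diff F i = 0.
Proof. exact: (cycles_diff i.+1). Qed.

Lemma cycles_mulmx i m1 m2 (A : 'M[R]_(m1, m2)) (M : 'M[R]_(m2, rank F i)) :
  cycles M -> cycles (A *m M).
Proof.
by move=> /cyclesP[W ->]; apply/cyclesP; exists (A *m W); rewrite mulmxA.
Qed.

Lemma cyclesN i m (M : 'M[R]_(m, rank F i)) : cycles M -> cycles (- M).
Proof.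
move=> h; have -> : - M = - 1%:M *m M by rewrite mulNmx mul1mx.
exact: cycles_mulmx.
Qed.

Lemma aug_homog_mx : homog_mx (@shift _ _ _ F 0) (fun=> 0) (aug F).
Proof. by move=> a b; rewrite ord1 subr0; exact: aug_homog. Qed.

Lemma diff_homog_mx i :
  homog_mx (@shift _ _ _ F i.+1) (@shift _ _ _ F i) (diff F i).
Proof. exact: diff_homog. Qed.

Lemma lift_homog i m (s : 'I_m -> int) (M : 'M[R]_(m, rank F i)) :
  homog_mx s (@shift _ _ _ F i) M -> cycles M ->
  exists2 W, homog_mx s (@shift _ _ _ F i.+1) W & M = W *m diff F i.
Proof.
move=> hM /cyclesP[W defM].
exists (zcomp_mx s (@shift _ _ _ F i.+1) W); first exact: homog_mx_zcomp.
by rewrite -(zcomp_mxM _ _ (@diff_homog_mx i)) -defM zcomp_mx_id.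
Qed.

End Cycles.

(** * Bounded resolutions and the horseshoe lemma *)

Definition shifts_le I (F : graded_free_resolution I) d :=
  forall i (a : 'I_(rank F i)), shift a <= i%:Z + d.

(** A witness for reg (R/I) <= d.  The resolution need not be minimal, which
    leaves horseshoes and cones free to produce superfluous generators. *)
Definition regularity_le I d :=
  exists F : graded_free_resolution I, shifts_le F d.

Lemma regularity_le_same I J d :
  same_set I J -> regularity_le I d -> regularity_le J d.
Proof.
move=> IJ [F hF].
have surj f : exists v : 'rV[R]_(rank F 0), J (f - (v *m aug F) 0 0).
  by have [v /IJ] := aug_surj F f; exists v.
have exact0 (v : 'rV[R]_(rank F 0)) :
    J ((v *m aug F) 0 0) <-> exists w, v = w *m diff F 0%N.
  by rewrite -aug_exact; split=> /IJ.
by exists (GradedFreeResolution (@aug_homog _ _ _ F) (@diff_homog _ _ _ F)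
  surj exact0 (@diff_exact _ _ _ F)).
Qed.

Lemma regularity_le_mono I d d' :
  d <= d' -> regularity_le I d -> regularity_le I d'.
Proof.
move=> le_dd' [F hF]; exists F => i a; apply: (le_trans (hF i a)).
by rewrite lerD2l.
Qed.

(** The horseshoe lemma for 0 -> R/(I : g)(-e) -> R/I -> R/(I + (g)) -> 0, where
    the first map is multiplication by g.  The resolution of R/I has the direct
    sum of the two given ones as modules, hence generators in the same degrees.
    Its differential is corrected by a map phi of degree 0 from the resolution F
    of R/(I + (g)) to the resolution F' of R/(I : g)(-e). *)
Lemma regularity_le_horseshoe I (g : R) (e d : int) :
  homogeneous_ideal I -> zhomog e g ->
  regularity_le (colon I g) (d - e) -> regularity_le (add_elt I g) d ->
  regularity_le I d.
Proof.
move=> homI hg [F' hF'] [F hF]; have [idI _] := homI.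
(* The degrees of the generators of the twisted resolution F'(-e). *)
pose s' i (a : 'I_(rank F' i)) := shift a + e.
have haug' : homog_mx (s' 0%N) (fun=> 0) (g *: aug F').
  rewrite -mul_scalar_mx; apply: homog_mxM (@aug_homog_mx _ F').
  exact: homog_mx_scalar.
have hdiff' i : homog_mx (s' i.+1) (s' i) (diff F' i).
  apply/homog_mx_shift => a b.
  by rewrite /s' addrK; exact: diff_homog.
(* The rows of diff F 0 map into I + (g); their g-part is lifted through F'. *)
have [W0 hW0 IW0] : exists2 W, homog_mx (@shift _ _ _ F 1) (s' 0%N) W
    & forall a, I ((diff F 0 *m aug F - W *m (g *: aug F')) a 0).
  apply: lift_homog_mod => // [|a].
    by apply: homog_mxM (@aug_homog_mx _ F); exact: diff_homog_mx.
  have /(add_eltP _ _ idI)[b Ib] := cycles_diff F 0 a.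
  have [v Iv] := aug_surj F' b; exists v.
  rewrite -scalemxAr [X in _ - X]mxE.
  have [_ ID _] := idI; move: (ID _ _ Ib Iv); congr (I _).
  by rewrite mulrBl addrA subrK [_ * g]mulrC.
(* The equation Q makes the block differential square to zero; phi can be
   continued as soon as diff F i.+1 times phi i consists of cycles of F'. *)
pose X i := 'M[R]_(rank F i.+1, rank F' i).
pose P i (W : X i) := homog_mx (@shift _ _ _ F i.+1) (s' i) W /\
  cycles (diff F i.+1 *m W).
pose Q i (W : X i) (W' : X i.+1) :=
  W' *m diff F' i + diff F i.+1 *m W = 0.
have P0 : P 0%N (- W0).
  split=> [|a]; first exact: homog_mxN.
  have := ideal_mulmx (diff F 1) idI IW0 a.
  rewrite mulmxBr !mulmxA diff_diff mul0mx sub0r; congr (I _).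
  by rewrite mulmxN mulNmx -scalemxAr -scalerN mxE mulrC.
have step i W : P i W -> exists2 W', P i.+1 W' & Q i W W'.
  move=> [hW cW].
  have hM : homog_mx (@shift _ _ _ F i.+2) (s' i) (- (diff F i.+1 *m W)).
    by apply: homog_mxN; apply: homog_mxM hW; exact: diff_homog_mx.
  have [W' hW' defW'] :=
    lift_homog ((homog_mx_shift _ _ _ _).1 hM) (cyclesN cW).
  exists W'; last by rewrite /Q -defW' addNr.
  split; first exact/homog_mx_shift.
  by rewrite /= -mulmxA -defW' mulmxN mulmxA diff_diff mul0mx oppr0.
have [phi [phi0 Pphi Qphi]] := dependent_choice_nat P0 step.
pose G_rank i := (rank F' i + rank F i)%N.
pose G_shift i : 'I_(G_rank i) -> int := sum_shift (s' i) (@shift _ _ _ F i).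
pose G_diff i : 'M[R]_(G_rank i.+1, G_rank i) :=
  block_mx (diff F' i) 0 (phi i) (diff F i).
pose G_aug : 'cV[R]_(G_rank 0%N) := col_mx (g *: aug F') (aug F).
have augE (v' : 'rV[R]_(rank F' 0)) (v : 'rV[R]_(rank F 0)) :
    (row_mx v' v *m G_aug) 0 0 = (v' *m aug F') 0 0 * g + (v *m aug F) 0 0.
  by rewrite mul_row_col mxE -scalemxAr mxE mulrC.
have diffE i (v' : 'rV[R]_(rank F' i.+1)) (v : 'rV[R]_(rank F i.+1)) :
    row_mx v' v *m G_diff i =
    row_mx (v' *m diff F' i + v *m phi i) (v *m diff F i).
  by rewrite mul_row_block mulmx0 add0r.
have G_aug_homog a : zhomog (G_shift 0%N a) (G_aug a 0).
  by have := homog_mx_col haug' (@aug_homog_mx _ F) a 0; rewrite subr0.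
have G_diff_homog i a b : zhomog (G_shift i.+1 a - G_shift i b) (G_diff i a b).
  apply: homog_mx_col a b; apply: homog_mx_row => //; first exact: homog_mx0.
    by have [] := Pphi i.
  exact: diff_homog_mx.
have G_aug_surj f : exists v : 'rV[R]_(G_rank 0%N), I (f - (v *m G_aug) 0 0).
  have [v /(add_eltP _ _ idI)[b Ib]] := aug_surj F f.
  have [v' Iv'] := aug_surj F' b; exists (row_mx v' v).
  have [_ ID _] := idI; move: (ID _ _ Ib Iv'); congr (I _).
  by rewrite augE; ring.
have phi_aug a : I ((phi 0%N *m aug F') a 0 * g + (diff F 0 *m aug F) a 0).
  have := IW0 a; congr (I _); rewrite phi0 mulNmx -scalemxAr -scalerN.
  by rewrite [LHS]mxE [LHS]addrC; congr (_ + _); rewrite mxE mulrC.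
have G_aug_exact (v : 'rV[R]_(G_rank 0%N)) :
    I ((v *m G_aug) 0 0) <-> exists w, v = w *m G_diff 0%N.
  have IE (w : 'rV[R]_(rank F 1)) : I ((w *m (phi 0%N)  *m aug F') 0 0 * g
      + (w *m diff F 0 *m aug F) 0 0).
    have := ideal_mulmx w idI (b := g *: (phi 0%N *m aug F')
       + diff F 0 *m aug F) _ 0.
    rewrite mulmxDr -scalemxAr !mulmxA 2!mxE mulrC; apply.
    by move=> a; rewrite 2!mxE mulrC; exact: phi_aug.
  split=> [|[w ->]].
    rewrite -[v]hsubmxK augE; set v1 := lsubmx v; set v2 := rsubmx v => Iv.
    have [w2 defv2] : exists w, v2 = w *m diff F 0%N.
      apply/aug_exact/(add_eltP _ _ idI); exists (- (v1 *m aug F') 0 0).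
      by rewrite mulNr opprK addrC.
    have [w1 defw1] : exists w, v1 - w2 *m phi 0%N = w *m diff F' 0%N.
      apply/aug_exact; rewrite /colon mulmxBl mxE [X in _ + X]mxE.
      move: (idealB idI Iv (IE w2)); congr (I _); rewrite defv2; ring.
    by exists (row_mx w1 w2); rewrite diffE -defw1 -defv2 subrK.
  rewrite -[w]hsubmxK diffE augE mulmxDl mxE mulrDl -addrA.
  have [_ ID _] := idI; apply: ID; last exact: IE.
  exact: (cycles_mulmx (lsubmx w) (cycles_diff F' 0)) 0.
have G_diff_exact i (v : 'rV[R]_(G_rank i.+1)) :
    v *m G_diff i = 0 <-> exists w, v = w *m G_diff i.+1.
  have Qi := Qphi i; rewrite /Q in Qi.
  split=> [|[w ->]].
    rewrite -[v]hsubmxK diffE; set v1 := lsubmx v; set v2 := rsubmx v.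
    rewrite -[0]row_mx0 => /eq_row_mx[E1 E2].
    have [w2 defv2] := (diff_exact v2).1 E2.
    have [w1 defw1] : exists w, v1 - w2 *m phi i.+1 = w *m diff F' i.+1.
      apply/diff_exact; rewrite mulmxBl -mulmxA.
      move/eqP: Qi; rewrite addr_eq0 => /eqP->; rewrite mulmxN opprK.
      by rewrite mulmxA -defv2.
    by exists (row_mx w1 w2); rewrite diffE -defw1 -defv2 subrK.
  rewrite -[w]hsubmxK !diffE mulmxDl -!mulmxA !diff_diff !mulmx0 add0r.
  by rewrite -mulmxDr Qi mulmx0 row_mx0.
exists (GradedFreeResolution G_aug_homog G_diff_homog G_aug_surj
  G_aug_exact G_diff_exact) => i a /=.
rewrite /G_shift /sum_shift; case: (split a) => b; last exact: hF.
by have := hF' i b; rewrite /s' addrA lerBrDr.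
Qed.

End Resolutions.

(** * Mapping cones *)

Section Cone.

Variables (K : fieldType) (n : nat).
Local Notation R := {mpoly K[n]}.
Implicit Types (I J : subset_of K n).

Section Definitions.
Variables (I : subset_of K n) (F : graded_free_resolution I) (e : int) (g : R).

(** The mapping cone of multiplication by g on F: its step i is the sum of F_i
    and F_(i-1)(-e), which is F_0 alone for i = 0. *)
Definition cone_rank i : nat :=
  if i is i'.+1 then (rank F i + rank F i')%N else rank F 0.

Definition cone_shift i : 'I_(cone_rank i) -> int :=
  match i with
  | 0%N => @shift _ _ _ F 0
  | i'.+1 => sum_shift (@shift _ _ _ F i'.+1)
               (fun a : 'I_(rank F i') => shift a + e)
  end.

Definition cone_diff i : 'M[R]_(cone_rank i.+1, cone_rank i) :=
  match i with
  | 0%N => col_mx (diff F 0) g%:M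
  | i'.+1 => block_mx (diff F i'.+1) 0 g%:M (- diff F i')
  end.

End Definitions.

(** For g a nonzerodivisor modulo I, the cone of multiplication by g resolves
    R/(I + (g)).  A generator of degree at most i - 1 + d moves to step i and
    degree at most i - 1 + d + e, which is where e <= 1 is used. *)
Lemma regularity_le_cone I (g : R) (e d : int) :
  is_ideal I -> zhomog e g -> e <= 1 ->
  same_set (colon I g) I -> regularity_le I d ->
  regularity_le (add_elt I g) d.
Proof.
move=> idI hg le_e1 nzd [F hF]; have [_ ID IM] := idI.
have G_diff_homog i a b :
    zhomog (cone_shift (F := F) e a - cone_shift e b) (cone_diff F g i a b).
  case: i a b => [|i] a b.
    by apply: homog_mx_col a b; [exact: diff_homog_mx | exact: homog_mx_scalar].
  apply: homog_mx_col a b; apply: homog_mx_row => //.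
  - exact: diff_homog_mx.
  - exact: homog_mx0.
  - exact: homog_mx_scalar.
  - apply/homog_mxN/homog_mx_shift => a b; rewrite addrK; exact: diff_homog.
have G_aug_surj f : exists v : 'rV[R]_(rank F 0),
    add_elt I g (f - (v *m aug F) 0 0).
  have [v Iv] := aug_surj F f; exists v; apply/add_eltP => //.
  by exists 0; rewrite mul0r subr0.
have diff0E (w : 'rV[R]_(rank F 1)) (u : 'rV[R]_(rank F 0)) :
    row_mx w u *m cone_diff F g 0 = w *m diff F 0 + g *: u.
  by rewrite mul_row_col mul_mx_scalar.
have diffSE i (w : 'rV[R]_(rank F i.+2)) (u : 'rV[R]_(rank F i.+1)) :
    row_mx w u *m cone_diff F g i.+1 =
    row_mx (w *m diff F i.+1 + g *: u) (- (u *m diff F i)).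
  by rewrite mul_row_block mulmx0 add0r mul_mx_scalar mulmxN.
have G_aug_exact (v : 'rV[R]_(rank F 0)) :
    add_elt I g ((v *m aug F) 0 0) <-> exists w, v = w *m cone_diff F g 0.
  split=> [/(add_eltP _ _ idI)[b Ib]|[w ->]].
    have [u Iu] := aug_surj F b.
    have [w defw] : exists w, v - g *: u = w *m diff F 0.
      apply/aug_exact; move: (ID _ _ Ib (IM g _ Iu)); congr (I _).
      rewrite mulmxBl -scalemxAl; move: (v *m aug F) (u *m aug F) => P Q.
      by rewrite !mxE; ring.
    by exists (row_mx w u); rewrite diff0E -defw subrK.
  apply/add_eltP => //; exists ((rsubmx w *m aug F) 0 0).
  rewrite -{1}[w]hsubmxK diff0E mulmxDl -scalemxAl.
  have := (cycles_mulmx (lsubmx w) (cycles_diff F 0)) 0; congr (I _).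
  move: (_ *m aug F) (rsubmx w *m aug F) => P Q.
  by rewrite !mxE; ring.
(* A cycle (w, u) of the cone is a boundary once u is a cycle of F. *)
have solve i (w : 'rV[R]_(rank F i.+1)) (u : 'rV[R]_(rank F i)) :
    w *m diff F i + g *: u = 0 -> cycles u ->
  exists s t, w = s *m diff F i.+1 + g *: t /\ u = - (t *m diff F i).
  move=> wu0 /cyclesN/cyclesP[t deft].
  have [s defs] : exists s, w - g *: t = s *m diff F i.+1.
    apply/cyclesP; rewrite /= mulmxBl -scalemxAl -deft scalerN opprK.
    exact: wu0.
  by exists s, t; rewrite -defs subrK -deft opprK.
have G_diff_exact i (v : 'rV[R]_(cone_rank F i.+1)) :
    v *m cone_diff F g i = 0 <-> exists w, v = w *m cone_diff F g i.+1.
  split=> [|[w ->]].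
    case: i v => [|i] v; rewrite -[v]hsubmxK.
      rewrite diff0E => v0.
      (* The augmentation of g u lies in I, hence so does that of u, because g
         is a nonzerodivisor modulo I. *)
      have cv : cycles (rsubmx v).
        move=> a; apply/nzd; rewrite /colon.
        have -> : (rsubmx v *m aug F) a 0 * g = ((g *: rsubmx v) *m aug F) a 0.
          by rewrite -scalemxAl [RHS]mxE mulrC.
        move/eqP: v0; rewrite addrC addr_eq0 => /eqP->.
        exact: (cyclesN (cycles_mulmx (lsubmx v) (cycles_diff F 0))) a.
      have [s [t [-> ->]]] := solve _ _ _ v0 cv.
      by exists (row_mx s t); rewrite diffSE.
    rewrite diffSE -[0]row_mx0 => /eq_row_mx[v0 /eqP].
    rewrite oppr_eq0 => /eqP cv.
    have [s [t [-> ->]]] := solve _ _ _ v0 cv.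
    by exists (row_mx s t); rewrite diffSE.
  rewrite -[w]hsubmxK diffSE; case: i {v} w => [|i] w.
    rewrite diff0E mulmxDl -mulmxA diff_diff mulmx0 add0r -scalemxAl.
    by rewrite scalerN subrr.
  rewrite diffSE mulmxDl -mulmxA diff_diff mulmx0 add0r -scalemxAl.
  by rewrite scalerN subrr mulNmx -mulmxA diff_diff mulmx0 oppr0 oppr0 row_mx0.
exists (@GradedFreeResolution _ _ (add_elt I g) (cone_rank F)
  (@cone_shift _ F e) (cone_diff F g) (aug F) (@aug_homog _ _ _ F)
  G_diff_homog G_aug_surj G_aug_exact G_diff_exact) => -[|i] a; first exact: hF.
rewrite /= /sum_shift; case: (split a) => b; first exact: hF.
by have := hF i b; lia.
Qed.

(** R itself is free with one generator in degree 0. *)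
Lemma regularity_le_zero I : same_set I (fun f => f = 0) -> regularity_le I 0.
Proof.
move=> I0.
pose r i : nat := (i == 0)%N.
have aug_homog (a : 'I_(r 0%N)) : zhomog 0 ((const_mx 1 : 'cV[R]_(r 0%N)) a 0).
  by rewrite mxE; exact: dhomog1.
have diff_homog i (a : 'I_(r i.+1)) (b : 'I_(r i)) :
  zhomog (0 - 0) ((0 : 'M[R]_(r i.+1, r i)) a b) by case: a.
have augE (v : 'rV[R]_(r 0%N)) :
    (v *m (const_mx 1 : 'cV[R]_(r 0%N))) 0 0 = v 0 0.
  by rewrite mxE big_ord1 mxE mulr1.
have surj f : exists v : 'rV[R]_(r 0%N),
    I (f - (v *m (const_mx 1 : 'cV[R]_(r 0%N))) 0 0).
  by exists (const_mx f); rewrite augE mxE subrr; apply/I0.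
have exact0 (v : 'rV[R]_(r 0%N)) :
    I ((v *m (const_mx 1 : 'cV[R]_(r 0%N))) 0 0) <->
    exists w : 'rV[R]_(r 1%N), v = w *m (0 : 'M[R]_(r 1%N, r 0%N)).
  rewrite augE; split=> [/I0 v0|[w ->]]; last by rewrite mulmx0 mxE; apply/I0.
  by exists 0; rewrite mulmx0; apply/rowP=> a; rewrite ord1 v0 mxE.
have exactS i (v : 'rV[R]_(r i.+1)) :
    v *m (0 : 'M[R]_(r i.+1, r i)) = 0 <->
    exists w : 'rV[R]_(r i.+2), v = w *m (0 : 'M[R]_(r i.+2, r i.+1)).
  by split=> _; [exists 0; apply/rowP; case | rewrite mulmx0].
exists (GradedFreeResolution aug_homog diff_homog surj exact0 exactS) => i a /=.
by lia.
Qed.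

End Cone.

(** * Intersections of primes generated by variables *)

Section MonomialIdeals.

Variables (K : fieldType) (n : nat).
Local Notation R := {mpoly K[n]}.
Implicit Types (I J : subset_of K n) (m : 'X_{1..n}) (f g : R).

Lemma mcoeff_zcomp d f m :
  (zcomp d f)@_m = if d == (mdeg m)%:Z then f@_m else 0.
Proof.
elim/mpolyind: f => [|c m' p _ _ IH]; first by rewrite zcomp0 mcoeff0 if_same.
rewrite zcompD zcompZ !mcoeffD !mcoeffZ IH zcompX.
have [<-|ne] := eqVneq m' m.
  by case: eqP => _; rewrite ?mcoeff0 ?mulr0 ?addr0.
rewrite (fun_if (mcoeff m)) mcoeff0 mcoeffX (negPf ne) if_same mulr0 add0r.
by rewrite add0r.
Qed.

Lemma ideal_of_monomials I f : is_ideal I ->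
  (forall m, m \in msupp f -> I 'X_[m]) -> I f.
Proof.
move=> idI If; rewrite [f]mpolyE big_seq; apply: ideal_sum => // m /If Im.
by rewrite -mul_mpolyC; have [_ _ IM] := idI; apply: IM.
Qed.

(** The K-span of the monomials in E, an ideal when E is upward closed.  Colons
    by a variable and sums with a variable are then read off from E. *)
Definition mideal (E : pred 'X_{1..n}) : subset_of K n :=
  fun f => forall m, m \in msupp f -> E m.

Lemma mideal_ext E E' : E =1 E' -> same_set (mideal E) (mideal E').
Proof. by move=> EE' f; split=> h m /h; rewrite EE'. Qed.

Definition upward_closed (E : pred 'X_{1..n}) :=
  forall m m', E m -> E (m' + m)%MM.

Lemma mideal_homogeneous E : upward_closed E -> homogeneous_ideal (mideal E).
Proof.
move=> upE; split; first split.
- by move=> m; rewrite msupp0.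
- move=> f g hf hg m /msuppD_le; rewrite mem_cat.
  by move=> /orP[]; [exact: hf | exact: hg].
- by move=> f g hg m /msuppM_le/allpairsP[[m1 m2] [_ /= /hg ? ->]]; apply: upE.
- move=> d f hf m; rewrite mcoeff_msupp mcoeff_zcomp.
  by case: ifP => _; rewrite ?eqxx // -mcoeff_msupp; exact: hf.
Qed.

Lemma mideal_colonX E i :
  same_set (colon (mideal E) 'X_i) (mideal (fun m => E (m + U_(i))%MM)).
Proof.
move=> f; split=> h m hm.
  by apply: h; rewrite addmC mcoeff_msupp mcoeffMX -mcoeff_msupp.
move: hm; rewrite (perm_mem (msuppMX _ _)) => /mapP[m' hm' ->].
by rewrite addmC; exact: h.
Qed.

Lemma mideal_addX E i : upward_closed E ->
  same_set (add_elt (mideal E) 'X_i) (mideal (fun m => E m || (0 < m i)%N)).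
Proof.
move=> upE; have [idE _] := mideal_homogeneous upE => f; split.
  move=> [a [b [ha ->]]] m /msuppD_le; rewrite mem_cat => /orP[/ha->//|].
  rewrite (perm_mem (msuppMX _ _)) => /mapP[m' _ ->].
  by rewrite mnmDE mnm1E eqxx orbT.
move=> hf; apply: ideal_of_monomials; first exact: add_elt_ideal.
move=> m /hf/orP[Em|mi].
  exists 'X_[m], 0; split; last by rewrite mul0r addr0.
  by move=> m'; rewrite msuppX inE => /eqP->.
exists 0, 'X_[m - U_(i)]; split; first by move=> m'; rewrite msupp0.
by rewrite add0r -mpolyXD submK // lep1mP -lt0n.
Qed.

(** Membership of a monomial in the intersection of the primes generated by the
    variables of A, for A in s. *)
Definition meets (s : seq {set 'I_n}) m :=
  all (fun A : {set 'I_n} => [exists i in A, (0 < m i)%N]) s.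

Lemma meets_up s : upward_closed (meets s).
Proof.
move=> m m' /allP h; apply/allP => A /h /exists_inP[i iA mi].
by apply/exists_inP; exists i; rewrite // mnmDE ltn_addl.
Qed.

Lemma meets_add s m i : meets s (m + U_(i))%MM =
  meets [seq A : {set 'I_n} <- s | i \notin A] m.
Proof.
rewrite /meets all_filter; apply: eq_all => A /=.
apply/exists_inP/implyP => [[k kA] h iA|].
  apply/exists_inP; exists k => //; move: h; rewrite mnmDE mnm1E.
  by case: eqP => [E|_]; [rewrite -E (negPf iA) in kA | rewrite addn0].
have [iA|iA] := boolP (i \in A) => h.
  by exists i; rewrite // mnmDE mnm1E eqxx addn1.
have /exists_inP[k kA mk] := h isT.
by exists k; rewrite // mnmDE ltn_addr.
Qed.

Lemma meets_or s m i :
  meets s m || (0 < m i)%N = meets [seq i |: A | A : {set 'I_n} <- s] m.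
Proof.
rewrite /meets all_map; case: ltnP => mi; rewrite ?orbT ?orbF.
  symmetry; apply/allP => A _; apply/exists_inP; exists i; rewrite ?setU11 //.
apply: eq_all => A /=; apply/exists_inP/exists_inP => -[k kA mk].
  by exists k; rewrite // inE kA orbT.
exists k => //; move: kA; rewrite !inE => /predU1P[E|//].
by rewrite E ltnNge mi in mk.
Qed.

Definition prime_cap s := mideal (meets s).

Lemma prime_cap_homogeneous s : homogeneous_ideal (prime_cap s).
Proof. exact/mideal_homogeneous/meets_up. Qed.

Lemma colon_prime_cap s i :
  same_set (colon (prime_cap s) 'X_i)
    (prime_cap [seq A : {set 'I_n} <- s | i \notin A]).
Proof.
move=> f; rewrite mideal_colonX; apply: mideal_ext => m.
exact: meets_add.
Qed.

Lemma add_prime_cap s i :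
  same_set (add_elt (prime_cap s) 'X_i)
    (prime_cap [seq i |: A | A : {set 'I_n} <- s]).
Proof.
move=> f; rewrite mideal_addX; last exact: meets_up.
by apply: mideal_ext => m; exact: meets_or.
Qed.

Lemma same_set_sym I J : same_set I J -> same_set J I.
Proof. by move=> IJ f; split=> /IJ. Qed.

(** The Koszul resolution: the variables of A form a regular sequence, so they
    are added one by one with mapping cones. *)
Lemma regularity_le_prime (A : {set 'I_n}) : regularity_le (prime_cap [:: A]) 0.
Proof.
have [k] := ubnP #|A|; elim: k A => // k IH A ltAk.
have [->|[x xA]] := set_0Vmem A.
  apply: regularity_le_zero => f; split=> [hf|->].
    apply/eqP; rewrite -msupp_eq0; case E: (msupp f) => [//|m l].
    have := hf m; rewrite E mem_head /meets /= andbT => /(_ isT).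
    by move=> /exists_inP[i]; rewrite inE.
  by move=> m; rewrite msupp0.
have leB : regularity_le (prime_cap [:: A :\ x]) 0.
  by apply: IH; rewrite (cardsD1 x) xA in ltAk.
apply: (@regularity_le_same _ _ (add_elt (prime_cap [:: A :\ x]) 'X_x)).
  by rewrite -[in prime_cap [:: A]](setD1K xA); exact: add_prime_cap.
apply: regularity_le_cone (zhomogX _ _) _ _ leB => //.
  by case: (prime_cap_homogeneous [:: A :\ x]).
by move=> f; rewrite colon_prime_cap /= !inE eqxx.
Qed.

(** The induction on variables.  The measure is the number of sets plus the
    sum over them of the number of variables that they miss: passing to I : x
    drops the sets that contain x, and passing to I + (x) leaves the number of
    sets unchanged and adds x to those that miss it. *)
Lemma regularity_le_prime_cap s : s != [::] ->
  regularity_le (prime_cap s) ((size s)%:Z - 1).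
Proof.
have [k] := ubnP (size s + \sum_(A <- s) #|~: A|).
elim: k s => // k IH s; rewrite ltnS => lesk s0.
have [|[A [B [x [As Bs xA xB]]]]] : (exists A, {in s, forall B, B = A}) \/
    exists A B x, [/\ A \in s, B \in s, x \in A & x \notin B].
- case: s {lesk} s0 => // A s _.
  have [/allP eqs|/allPn[B Bs neAB]] := boolP (all (pred1 A) (A :: s)).
    by left; exists A => B /eqs/eqP.
  right; case: (boolP (A \subset B)) => [AB|/subsetPn[x xA xB]].
    have /subsetPn[x xB xA] : ~~ (B \subset A).
      by apply: contra neAB => BA /=; rewrite eqEsubset BA.
    by exists B, A, x; rewrite mem_head.
  by exists A, B, x; rewrite mem_head.
- move=> [A eqA].
  apply: (@regularity_le_mono _ _ _ 0).
    by case: s s0 {lesk eqA} => //= *; lia.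
  apply: regularity_le_same (regularity_le_prime A).
  apply: mideal_ext => m; rewrite /meets /= andbT.
  apply/idP/allP => [h B /eqA->//|h].
  case: s s0 eqA h {lesk} => // B s _ eqA /(_ B (mem_head _ _)).
  by rewrite (eqA B (mem_head _ _)).
(* A is dropped from s. *)
have size1 : (size [seq C : {set 'I_n} <- s | x \notin C] < size s)%N.
  rewrite size_filter ltn_neqAle count_size andbT -all_count.
  by apply/negP => /allP/(_ A As); rewrite xA.
apply: (regularity_le_horseshoe (prime_cap_homogeneous s) (zhomogX _ x)).
  have le_size : (size [seq C : {set 'I_n} <- s | x \notin C])%:Z - 1
      <= (size s)%:Z - 1 - 1 by lia.
  apply: (regularity_le_mono le_size).
  apply: regularity_le_same (same_set_sym (colon_prime_cap s x)) _.
  apply: IH.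
    apply: leq_trans lesk; rewrite big_filter.
    rewrite [X in (_ < _ + X)%N](bigID (fun C : {set 'I_n} => x \notin C)) /=.
    by rewrite -addSn leq_add // leq_addr.
  by rewrite -has_filter; apply/hasP; exists B.
apply: regularity_le_same (same_set_sym (add_prime_cap s x)) _.
rewrite -(size_map (fun C => x |: C) s); apply: IH; last by case: (s) s0.
apply: leq_trans lesk; rewrite size_map ltn_add2l big_map.
rewrite (big_rem B) //= [X in (_ < X)%N](big_rem B) //= -addSn leq_add //.
  apply: proper_card; rewrite properE setCS subsetUr setCS.
  by apply: contra xB => /subsetP; apply; exact: setU11.
by apply: leq_sum => C _; apply: subset_leq_card; rewrite setCS subsetUr.
Qed.

End MonomialIdeals.

(** * Independence of the resolution *)

Section Comparison.

Variables (K : fieldType) (n : nat).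
Local Notation R := {mpoly K[n]}.
Implicit Types (I : subset_of K n).

Definition chain_map_over_id I (F G : graded_free_resolution I)
    (f : forall i, 'M[R]_(rank F i, rank G i)) :=
  (forall a, I ((aug F - f 0%N *m aug G) a 0)) /\
  forall i, f i.+1 *m diff G i = diff F i *m f i.

(** The comparison theorem; the grading of f matters later, when f is shown to
    kill classes of large degree. *)
Lemma comparison I (F G : graded_free_resolution I) : homogeneous_ideal I ->
  exists2 f : forall i, 'M[R]_(rank F i, rank G i), chain_map_over_id f
    & forall i, homog_mx (@shift _ _ _ F i) (@shift _ _ _ G i) (f i).
Proof.
move=> homI; have [idI _] := homI.
have [f0 hf0 If0] := lift_homog_mod homI (@aug_homog_mx _ _ _ F)
  (@aug_homog_mx _ _ _ G) (fun a => aug_surj G (aug F a 0)).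
pose P i (W : 'M[R]_(rank F i, rank G i)) :=
  homog_mx (@shift _ _ _ F i) (@shift _ _ _ G i) W /\ cycles (diff F i *m W).
pose Q i (W : 'M[R]_(rank F i, rank G i))
    (W' : 'M[R]_(rank F i.+1, rank G i.+1)) :=
  W' *m diff G i = diff F i *m W.
have P0 : P 0%N f0.
  split=> // a.
  have := idealB idI (cycles_diff F 0 a) (ideal_mulmx (diff F 0) idI If0 a).
  congr (I _); rewrite mulmxBr mulmxA.
  by move: (_ *m aug F) (_ *m aug G) => A B; rewrite !mxE; ring.
have step i W : P i W -> exists2 W', P i.+1 W' & Q i W W'.
  move=> [hW cW].
  have [W' hW' defW'] :=
    lift_homog (homog_mxM (@diff_homog_mx _ _ _ F i) hW) cW.
  exists W' => //; split => //=.
  by rewrite -mulmxA -defW' mulmxA diff_diff mul0mx.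
have [f [ff0 Pf Qf]] := dependent_choice_nat P0 step.
exists f => [|i]; last by case: (Pf i).
by split=> [a|i]; [rewrite ff0 | exact: Qf].
Qed.

Lemma chain_map_comp I (F G H : graded_free_resolution I) f g : is_ideal I ->
  @chain_map_over_id I F G f -> @chain_map_over_id I G H g ->
  chain_map_over_id (fun i => f i *m g i).
Proof.
move=> idI [If df] [Ig dg]; have [_ ID _] := idI; split=> [a|i].
  move: (ID _ _ (If a) (ideal_mulmx (f 0%N) idI Ig a)); congr (I _).
  rewrite mulmxBr mulmxA.
  by move: (aug F) (_ *m aug G) (_ *m aug H) => A B C; rewrite !mxE; ring.
by rewrite -mulmxA dg mulmxA df mulmxA.
Qed.

Lemma homotopy_to_id I (F : graded_free_resolution I) c :
  @chain_map_over_id I F F c ->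
  exists h : forall i, 'M[R]_(rank F i, rank F i.+1),
    h 0%N *m diff F 0 = 1%:M - c 0%N /\
    forall i, h i.+1 *m diff F i.+1 = 1%:M - c i.+1 - diff F i *m h i.
Proof.
move=> [Ic dc].
have [h0 defh0] : exists h0, 1%:M - c 0%N = h0 *m diff F 0.
  by apply/cyclesP => a; rewrite mulmxBl mul1mx.
pose P i (h : 'M[R]_(rank F i, rank F i.+1)) :=
  cycles (1%:M - c i.+1 - diff F i *m h).
pose Q i (h : 'M[R]_(rank F i, rank F i.+1))
    (h' : 'M[R]_(rank F i.+1, rank F i.+2)) :=
  h' *m diff F i.+1 = 1%:M - c i.+1 - diff F i *m h.
have P0 : P 0%N h0.
  rewrite /P /= 2!mulmxBl mul1mx dc -mulmxA -defh0 mulmxBr mulmx1.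
  exact: subrr.
have step i h : P i h -> exists2 h', P i.+1 h' & Q i h h'.
  move=> /cyclesP[h' defh']; exists h' => //.
  rewrite /P /= 2!mulmxBl mul1mx dc -mulmxA -defh' 2!mulmxBr mulmx1.
  by rewrite mulmxA diff_diff mul0mx subr0 subrr.
have [h [hh0 Ph Qh]] := dependent_choice_nat P0 step.
by exists h; split=> [|i]; [rewrite hh0 -defh0 | exact: Qh].
Qed.

Definition const m1 m2 (A : 'M[R]_(m1, m2)) : 'M[K]_(m1, m2) :=
  map_mx (mcoeff 0%MM) A.

(** With f : F -> G into a bounded resolution G and g : G -> F, the class of v is
    that of v f g, as f g is homotopic to the identity.  Modulo the variables,
    only the entries of f between generators of equal degree survive, and G_i has
    no generator in a degree j > i + d. *)
Lemma homology_shifts I (F : graded_free_resolution I) d i j :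
  homogeneous_ideal I -> regularity_le I d -> homology_nonzero F i j ->
  j - i%:Z <= d.
Proof.
move=> homI [G hG] [v [degv cyv]] nbv; have [idI _] := homI.
rewrite leNgt; apply/negP => ltd; apply: nbv.
have [f cf hf] := comparison F G homI; have [g cg _] := comparison G F homI.
have [h [h0 hS]] := homotopy_to_id (chain_map_comp idI cf cg).
have vf0 : v *m const (f i) = 0.
  apply/rowP=> b; rewrite mxE [RHS]mxE big1 // => a _; rewrite mxE.
  apply/eqP; rewrite mulf_eq0; apply/norP => -[/degv va fab].
  have := zhomog_mcoeff0 (hf i a b) fab; have := hG i b; rewrite va; lia.
have vfg0 : v *m const (f i *m g i) = 0.
  by rewrite /const map_mxM mulmxA vf0 mul0mx.
exists (v *m const (h i)).
have -> : diffK F i = const (diff F i) by [].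
rewrite -mulmxA -map_mxM.
case: i v degv cyv {ltd vf0} vfg0 => [|i] v degv cyv vfg0.
  by rewrite h0 map_mxB map_mx1 mulmxBr mulmx1 vfg0 subr0.
rewrite hS 2!map_mxB map_mx1 2!mulmxBr mulmx1 vfg0 subr0.
by rewrite map_mxM mulmxA cyv mul0mx subr0.
Qed.

(** * Existence of the regularity *)

(** The constant coefficient of f is its component of degree 0, which lies in I
    along with f. *)
Lemma mcoeff0_proper I f : homogeneous_ideal I -> ~ I 1 -> I f -> f@_0%MM = 0.
Proof.
move=> [[_ _ IM] homI] nI1 If; apply/eqP/negPn/negP => f0; apply: nI1.
have E : zcomp 0 f = (f@_0%MM)%:MP.
  apply/mpolyP => m; rewrite mcoeff_zcomp mcoeffC eqz_nat eq_sym mdeg_eq0.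
  by case: eqP => [->|_]; rewrite ?mulr1 ?mulr0.
have := IM (f@_0%MM)^-1%:MP _ (homI 0 _ If).
by rewrite E -mpolyCM mulVf.
Qed.

(** Tor_0 (R/I, K) is R/I modulo the variables, that is K.  Concretely, some
    generator of F_0 has an augmentation with nonzero constant term, since 1 is
    in the image modulo I; it has degree 0, and it is not a boundary since
    boundaries augment into I. *)
Lemma homology00 I (F : graded_free_resolution I) :
  homogeneous_ideal I -> ~ I 1 -> homology_nonzero F 0 0.
Proof.
move=> homI nI1.
have [v Iv] := aug_surj F 1.
have [a augF_a] : exists a, (aug F a 0)@_0%MM != 0.
  apply/existsP; apply: contraT => /existsPn aug0.
  have := mcoeff0_proper homI nI1 Iv.
  rewrite mcoeffB mcoeff1 eqxx mxE raddf_sum big1 ?subr0 => [/eqP|b _].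
    by rewrite oner_eq0.
  rewrite /= (rmorphM (mcoeff 0%MM)) /=.
  by have /negPn/eqP-> := aug0 b; rewrite mulr0.
have sa := zhomog_mcoeff0 (aug_homog a) augF_a.
exists (delta_mx 0 a); split=> // [b|[w defw]].
  by rewrite mxE eqxx /=; case: (b =P a) => [->|_]; rewrite ?sa ?eqxx.
have dKa : diffK F 0 *m const (aug F) = 0.
  rewrite -[diffK F 0]/(const (diff F 0)) -map_mxM.
  apply/colP=> b; rewrite mxE [RHS]mxE.
  exact: mcoeff0_proper homI nI1 (cycles_diff F 0 b).
move/negP: augF_a; apply; apply/eqP.
have := congr1 (fun u => (u *m const (aug F)) 0 0) defw.
by rewrite -mulmxA dKa mulmx0 -rowE 3!mxE.
Qed.

(** Every upper bound of the set of all j - i is nonnegative, as j - i = 0 occurs;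
    so the least one is found among the natural numbers. *)
Lemma is_reg_exists I d : homogeneous_ideal I -> ~ I 1 ->
  regularity_le I d -> exists2 d', is_reg I d' & d' <= d.
Proof.
move=> homI nI1 regI.
pose ub e := forall i j, Tor_nonzero I i j -> j - i%:Z <= e.
have ub_ge0 e : ub e -> 0 <= e.
  have [F _] := regI => /(_ 0%N 0); rewrite subr0; apply.
  by exists F; exact: homology00.
have ub_d : ub d by move=> i j [F]; exact: homology_shifts.
pose ubb k : bool :=
  if excluded_middle_informative (ub (Posz k)) then true else false.
have ubbP k : reflect (ub (Posz k)) (ubb k).
  by rewrite /ubb; case: excluded_middle_informative => h; constructor.
have exk e : ub e -> exists2 k, ubb k & e = Posz k.
  move=> ube; have := ub_ge0 e ube.
  by case: e ube => // k ? _; exists k => //; apply/ubbP.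
have ex : exists k, ubb k by have [k] := exk d ub_d; exists k.
case: (ex_minnP ex) => k /ubbP ubk mink; exists (Posz k).
  by split=> // e /exk[l /mink lekl ->].
by have [l /mink lekl ->] := exk d ub_d.
Qed.

(** * Minimal primes of a monomial ideal *)

Lemma prime_monomial (p : subset_of K n) (m : 'X_{1..n}) :
  is_prime p -> p 'X_[m] -> exists2 x, (0 < m x)%N & p 'X_x.
Proof.
move=> [[_ p1] pM]; rewrite mpolyXE_id.
elim: (index_enum _) => [|x r IH]; first by rewrite big_nil.
rewrite big_cons => /pM[|/IH//] pX; exists x.
  by case: (m x) pX => // /p1.
by elim: (m x) pX => [/p1|k IHk] //; rewrite exprS => /pM[].
Qed.

(** Let A_i be the set of variables in p_i.  A generator of I lies in every p_i,
    hence some variable of it lies in A_i; so I is contained in the intersection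
    of the P_(A_i), which is contained in that of the p_i, which is I. *)
Lemma monomial_ideal_prime_cap I r (p : 'I_r -> subset_of K n) :
  monomial_ideal I -> (forall i, is_prime (p i)) ->
  (forall f, I f <-> forall i, p i f) ->
  exists2 s, size s = r & same_set I (prime_cap s).
Proof.
move=> [S genS] pr capI.
pose A i : {set 'I_n} :=
  [set x | if excluded_middle_informative (p i 'X_x) then true else false].
have inA i x : reflect (p i 'X_x) (x \in A i).
  by rewrite inE; case: excluded_middle_informative => h; constructor.
exists [seq A i | i <- enum 'I_r]; first by rewrite size_map size_enum_ord.
have [idcap _] := prime_cap_homogeneous K [seq A i | i <- enum 'I_r].
move=> f; split=> [/genS|hf].
  apply=> // _ [m Sm ->] m'; rewrite msuppX inE => /eqP->.
  have /capI Im : I 'X_[m] by apply/genS => J _; apply; exists m.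
  apply/allP => _ /mapP[i _ ->].
  have [x mx px] := prime_monomial (pr i) (Im i).
  by apply/exists_inP; exists x => //; apply/inA.
apply/capI => i; have [[idp _] _] := pr i; have [_ _ pM] := idp.
apply: ideal_of_monomials => // m /hf/allP/(_ (A i)).
move=> /(_ (map_f _ (mem_enum _ i)))/exists_inP[x /inA px mx].
have <- : (m - U_(x) + U_(x))%MM = m by rewrite submK // lep1mP -lt0n.
by rewrite mpolyXD; exact: pM.
Qed.

End Comparison.

Theorem proposition3p9 (K : fieldType) (n r : nat)
    (I : subset_of K n) (p : 'I_r -> subset_of K n)
    (hI : squarefree_monomial_ideal I)
    (hp : minimal_prime_decomposition I p)
    (hdec : ass_decomposable I) :
  exists d : int, is_reg I d /\ d <= r%:Z - 1.
Proof.
have nI1 : ~ I 1 by case: hdec => [_ []|? ? _ []].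
have [S _ genS] := hI; have [pr capI _ _] := hp.
have [s sz capIs] := monomial_ideal_prime_cap (ex_intro _ S genS) pr capI.
have [idcap homcap] := prime_cap_homogeneous K s.
have homI : homogeneous_ideal I.
  have [c0 cD cM] := idcap; split; first split.
  - exact/capIs.
  - by move=> f g /capIs hf /capIs hg; apply/capIs/cD.
  - by move=> f g /capIs hg; apply/capIs/cM.
  - by move=> d f /capIs hf; apply/capIs/homcap.
(* The empty intersection is the unit ideal. *)
have s0 : s != [::].
  by apply: contra_notN nI1 => /eqP s0; apply/capIs; rewrite s0.
have regI : regularity_le I (r%:Z - 1).
  rewrite -sz; apply: regularity_le_same (same_set_sym capIs) _.
  exact: regularity_le_prime_cap.
by have [d regd led] := is_reg_exists homI nI1 regI; exists d.
Qed.
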